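(* Let $n\ge 3$, $\beta\in(0,1)$, and let $c_{ij}$ ($i,j\in\{1,\dots,n\}$, $i\ne j$) be real distances. Consider the mixed integer program $\mathrm{TSP}_H(\beta)$ in variables $x_{ij},z_{ij}$ ($i,j\in\{1,\dots,n\}$, $i\neq j$): $$\begin{aligned}\min\ & \sum_{i=1}^n\sum_{j\ne i}c_{ij}z_{ij}\\ \text{s.t. }& \sum_{j=2}^n x_{1j}-\beta\sum_{j=2}^n x_{j1}=1-\beta^n,\\ & \sum_{j\ne i}x_{ij}-\beta\sum_{j\ne i}x_{ji}=0, && i=2,\dots,n,\\ & \sum_{j=2}^n x_{1j}=1,\\ & x_{1j}=z_{1j}, && j=2,\dots,n,\\ & x_{j1}=\beta^{n-1}z_{j1}, && j=2,\dots,n,\\ & \beta^{n-2}z_{ij}\le x_{ij}\le\beta z_{ij}, && i,j=2,\dots,n,\ i\neq j,\\ & \sum_{j\ne i}z_{ij}=1, && i=1,\dots,n,\\ & x_{ij}\ge0,\ z_{ij}\in\{0,1\}, && i,j=1,\dots,n,\ i\ne j.\end{aligned}$$ Then the feasible solutions of $\mathrm{TSP}_H(\beta)$ are exactly Hamiltonian cycles: for every feasible $(x,z)$ the arcs $(i,j)$ with $z_{ij}=1$ form a Hamiltonian cycle of the complete directed graph on $\{1,\dots,n\}$, and every Hamiltonian cycle arises in this way. Consequently $\mathrm{TSP}_H(\beta)$ is a formulation of the asymmetric traveling salesman problem, i.e. its optimal value is the minimum length of a tour.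
   Context: A tour (Hamiltonian cycle) is a directed cycle visiting each of the nodes $1,\dots,n$ exactly once; its length is the sum of $c_{ij}$ over its arcs $(i,j)$. All sums over $j\neq i$ run over $j\in\{1,\dots,n\}\setminus\{i\}$. The asymmetric traveling salesman problem asks for a tour of minimum length (with $c_{ij}$ and $c_{ji}$ possibly different). *)

(* Defs.v *)
From mathcomp Require Import all_boot all_order all_algebra.

Set Implicit Arguments.
Unset Strict Implicit.
Unset Printing Implicit Defensive.

Import Order.TTheory GRing.Theory Num.Theory.
Local Open Scope ring_scope.

(** The nodes 1, ..., n are the ordinals 0, ..., n-1 of ['I_n]; node 1 is the
    ordinal 0.  Quantities indexed by arcs (i, j) with i != j are functions
    ['I_n -> 'I_n -> R] whose diagonal values are never read. *)
Definition node1 (n : nat) (hn : (2 < n)%N) : 'I_n :=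
  Ordinal (leq_trans (isT : (0 < 3)%N) hn).

(** Constraints of TSP_H(beta), for 1 = [o]; "i = 2, ..., n" is [i != o]. *)
Record TSPH_feasible (R : realFieldType) (n : nat) (o : 'I_n) (beta : R)
    (x z : 'I_n -> 'I_n -> R) : Prop := TSPHFeasible {
  TSPH_flow1 :
    \sum_(j | j != o) x o j - beta * \sum_(j | j != o) x j o = 1 - beta ^+ n;
  TSPH_flow : forall i, i != o ->
    \sum_(j | j != i) x i j - beta * \sum_(j | j != i) x j i = 0;
  TSPH_unit : \sum_(j | j != o) x o j = 1;
  TSPH_out1 : forall j, j != o -> x o j = z o j;
  TSPH_in1 : forall j, j != o -> x j o = beta ^+ (n - 1) * z j o;
  TSPH_bounds : forall i j, i != o -> j != o -> i != j ->
    beta ^+ (n - 2) * z i j <= x i j /\ x i j <= beta * z i j;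
  TSPH_assign : forall i, \sum_(j | j != i) z i j = 1;
  TSPH_nonneg : forall i j, i != j -> 0 <= x i j;
  TSPH_binary : forall i j, i != j -> z i j = 0 \/ z i j = 1
}.

Definition TSPH_objective (R : realFieldType) (n : nat)
    (c z : 'I_n -> 'I_n -> R) : R :=
  \sum_i \sum_(j | j != i) c i j * z i j.

Definition selected_arcs (R : realFieldType) (n : nat)
    (z : 'I_n -> 'I_n -> R) : {set 'I_n * 'I_n} :=
  [set a | (a.1 != a.2) && (z a.1 a.2 == 1)].

(** [next p i] is the cyclic successor of [i] in [p]. *)
Definition cycle_arcs (n : nat) (p : seq 'I_n) : {set 'I_n * 'I_n} :=
  [set (i, next p i) | i in p].

Definition hamiltonian_cycle (n : nat) (A : {set 'I_n * 'I_n}) : Prop :=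
  exists p : seq 'I_n,
    [/\ uniq p, (forall i, i \in p) & A = cycle_arcs p].

Definition tour_length (R : realFieldType) (n : nat)
    (c : 'I_n -> 'I_n -> R) (A : {set 'I_n * 'I_n}) : R :=
  \sum_(a in A) c a.1 a.2.

Definition is_minimum (R : realFieldType) (S : R -> Prop) (v : R) : Prop :=
  S v /\ forall w, S w -> v <= w.

Definition TSPH_optimal_value (R : realFieldType) (n : nat) (o : 'I_n)
    (beta : R) (c : 'I_n -> 'I_n -> R) : R -> Prop :=
  is_minimum (fun v => exists x z,
    TSPH_feasible o beta x z /\ v = TSPH_objective c z).

Definition min_tour_length (R : realFieldType) (n : nat)
    (c : 'I_n -> 'I_n -> R) : R -> Prop :=
  is_minimum (fun v => exists A,
    hamiltonian_cycle A /\ v = tour_length c A).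

(* Main.v *)
(** On a feasible point each node [i] has a unique selected successor [f i], and
    [x] vanishes off the arcs [(i, f i)], where it takes a positive value [y i].
    Flow conservation then forces every node to have a predecessor, so [f] is a
    permutation, and [y (f i) = beta * y i] whenever [f i] is not node 1.  A
    cycle of length [k] avoiding node 1 would give [y i = beta ^+ k * y i], which
    is absurd.  Conversely a tour started at node 1 is encoded by putting
    [beta ^+ k] on the arc leaving its [k]-th node, counting from 0. *)
Require Import Defs.
From mathcomp Require Import all_boot all_order all_algebra.

Set Implicit Arguments.
Unset Strict Implicit.
Unset Printing Implicit Defensive.

Import Order.TTheory GRing.Theory Num.Theory.
Local Open Scope ring_scope.

(** * Binary sums, arc sets and orbits *)

(** A sum of 0/1 values is the cardinality of the support cast into [R]; the cast is injective, so
    the support is a singleton. *)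
Lemma binary_sum_eq1 (R : numDomainType) (I : finType) (P : pred I) (u : I -> R) :
    (forall j, P j -> u j = 0 \/ u j = 1) -> \sum_(j | P j) u j = 1 ->
  exists2 k, P k & forall j, P j -> u j = (j == k)%:R.
Proof.
move=> u01 sum1; pose A := [pred j | P j && (u j == 1)].
have uE j : P j -> u j = (A j)%:R.
  move=> Pj; rewrite /= Pj; case: (u01 j Pj) => ->; rewrite ?eqxx //.
  by rewrite eq_sym oner_eq0.
have cardA : #|A| == 1%N.
  rewrite -(eqr_nat R) -[1%:R in X in _ == X]sum1 (eq_bigr _ uE) -natr_sum.
  rewrite eqr_nat -sum1_card big_mkcond [X in _ == X]big_mkcond /=.
  by apply/eqP/eq_bigr => j _; rewrite unfold_in /=; case: (P j) => //=; case: eqP.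
have [k Ak] := mem_card1 (eqP cardA).
have /andP[Pk _] : k \in A by rewrite Ak inE.
by exists k => // j Pj; rewrite uE // -[A j]/(j \in A) Ak inE.
Qed.

Lemma tour_length_selected_arcs (R : realFieldType) (n : nat)
    (c z : 'I_n -> 'I_n -> R) :
    (forall i j, i != j -> z i j = 0 \/ z i j = 1) ->
  TSPH_objective c z = tour_length c (selected_arcs z).
Proof.
move=> z01; rewrite /TSPH_objective /tour_length pair_big_dep /=.
rewrite big_mkcond [RHS]big_mkcond /=; apply: eq_bigr => -[i j] _ /=.
rewrite inE /= [j == i]eq_sym; case: (boolP (i != j)) => //= /z01[] ->.
  by rewrite mulr0 eq_sym oner_eq0.
by rewrite mulr1 eqxx.
Qed.

(** Injectivity closes the orbit of [o] into a cycle along which [next] is [f]; connectivity makes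
    it reach every node. *)
Lemma hamiltonian_cycle_orbit (n : nat) (f : 'I_n -> 'I_n) (o : 'I_n) :
    injective f -> (forall i, fconnect f o i) ->
  hamiltonian_cycle [set (i, f i) | i in 'I_n].
Proof.
move=> f_inj o_conn.
have o_all i : i \in orbit f o by rewrite -fconnect_orbit.
have nextE i : next (orbit f o) i = f i.
  exact/esym/eqP/(next_cycle (cycle_orbit f_inj o)).
exists (orbit f o); split=> //; first exact: orbit_uniq.
by apply/setP=> a; apply/imsetP/imsetP => -[i _ ->]; exists i; rewrite ?nextE.
Qed.

Lemma iter_contraction (R : realFieldType) (T : finType) (f : T -> T) (o : T)
    (beta : R) (y : T -> R) :
    beta < 1 -> injective f -> 0 <= beta -> (forall i, 0 < y i) ->
    (forall i, f i != o -> y (f i) = beta * y i) ->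
  forall i, fconnect f o i.
Proof.
move=> beta1 f_inj beta0 y_gt0 yf i; rewrite fconnect_sym //.
apply/negPn/negP => i_o.
have y_iter k : y (iter k f i) = beta ^+ k * y i.
  elim: k => [|k IHk]; first by rewrite mul1r.
  rewrite iterS yf ?IHk ?exprS ?mulrA //.
  (* An iterate of [i] equal to [o] would connect [i] to [o]. *)
  by apply: contraNneq i_o => <-; rewrite -iterS fconnect_iter.
have := y_iter (order f i); rewrite iter_order // -{1}[y i]mul1r.
move/(mulIf (lt0r_neq0 (y_gt0 i))) => beta_k.
have : beta ^+ order f i < 1 by rewrite exprn_ilt1 // -lt0n order_gt0.
by rewrite -beta_k ltxx.
Qed.

(** * From feasible points to Hamiltonian cycles *)

Section Feasible.

Variables (R : realFieldType) (n : nat) (o : 'I_n) (beta : R).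
Variables (x z : 'I_n -> 'I_n -> R).
Hypothesis beta0 : 0 < beta.
Hypothesis feas : TSPH_feasible o beta x z.

Lemma feasible_successor :
  exists f : 'I_n -> 'I_n,
    forall i, f i != i /\ forall j, j != i -> z i j = (j == f i)%:R.
Proof.
apply: (@fin_all_exists _ (fun=> 'I_n) (fun i k =>
  k != i /\ forall j, j != i -> z i j = (j == k)%:R)) => i.
have [|k ki zE] := binary_sum_eq1 (P := fun j => j != i) _ (TSPH_assign feas i).
  by move=> j ji; apply: (TSPH_binary feas); rewrite eq_sym.
by exists k.
Qed.

Variable f : 'I_n -> 'I_n.
Hypothesis f_neq : forall i, f i != i.
Hypothesis zE : forall i j, j != i -> z i j = (j == f i)%:R.

Let y i := x i (f i).

(** Here [z i j = 0], and [x i j] is tied to it by an equation for arcs at [o], by two-sided bounds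
    elsewhere. *)
Lemma feasible_x_eq0 i j : j != i -> j != f i -> x i j = 0.
Proof.
move=> ji jf; have zij : z i j = 0 by rewrite zE // (negbTE jf).
have [io | io] := eqVneq i o.
  by rewrite io (TSPH_out1 feas) -?io.
have [jo | jo] := eqVneq j o.
  by rewrite jo (TSPH_in1 feas) // -jo zij mulr0.
have ij : i != j by rewrite eq_sym.
have [] := TSPH_bounds feas io jo ij; rewrite zij !mulr0 => x_ge0 x_le0.
by apply/eqP; rewrite eq_le x_le0.
Qed.

Lemma feasible_flow_gt0 i : 0 < y i.
Proof.
rewrite /y; have zf : z i (f i) = 1 by rewrite zE // eqxx.
have [io | io] := eqVneq i o.
  by rewrite [in x i]io (TSPH_out1 feas) -io // zf.
have [fo | fo] := eqVneq (f i) o.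
  by rewrite fo (TSPH_in1 feas) // -fo zf mulr1 exprn_gt0.
have fi : i != f i by rewrite eq_sym.
have [x_ge _] := TSPH_bounds feas io fo fi.
by apply: lt_le_trans x_ge; rewrite zf mulr1 exprn_gt0.
Qed.

Lemma feasible_outflow i : \sum_(j | j != i) x i j = y i.
Proof.
rewrite (bigD1 (f i)) //= big1 ?addr0 // => j /andP[].
exact: feasible_x_eq0.
Qed.

(** Without a predecessor the inflow is zero. At [o] the flow equation would read
    [1 = 1 - beta ^+ n]; elsewhere it would make the positive outflow vanish. *)
Lemma feasible_predecessor i : exists j, f j = i.
Proof.
apply/'exists_eqP; apply: contraT => /existsPn no_pred.
have in0 : \sum_(j | j != i) x j i = 0.
  by apply: big1 => j ji; apply: feasible_x_eq0; rewrite eq_sym.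
have [io | io] := eqVneq i o.
  have := TSPH_flow1 feas; rewrite (TSPH_unit feas) -io in0 mulr0 subr0 => one_eq.
  have : 1 - beta ^+ n < 1 by rewrite ltrBlDr ltrDl exprn_gt0.
  by rewrite -one_eq ltxx.
have := TSPH_flow feas io; rewrite in0 feasible_outflow mulr0 subr0 => /eqP.
by rewrite gt_eqF // feasible_flow_gt0.
Qed.

Lemma feasible_successor_inj : injective f.
Proof.
(* A right inverse of a self-map of a finite type is also a left inverse. *)
have [g gK] := fin_all_exists feasible_predecessor.
exact: can_inj (canF_sym gK).
Qed.

(** By injectivity of [f], the arc from [i] carries the whole inflow of [f i]. *)
Lemma feasible_flow_step i : f i != o -> y (f i) = beta * y i.
Proof.
move=> fo; apply/eqP; rewrite -subr_eq0 -feasible_outflow.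
have <- : \sum_(j | j != f i) x j (f i) = y i.
  rewrite (bigD1 i) 1?eq_sym //= big1 ?addr0 // => j /andP[jf ji].
  by apply: feasible_x_eq0; rewrite 1?eq_sym // (inj_eq feasible_successor_inj).
by rewrite (TSPH_flow feas).
Qed.

Lemma feasible_selected_arcs : selected_arcs z = [set (i, f i) | i in 'I_n].
Proof.
apply/setP=> -[i j]; rewrite inE /=; apply/andP/imsetP.
  move=> [ij]; rewrite zE 1?eq_sym //; have [-> _|_] := eqVneq j (f i).
    by exists i.
  by rewrite oner_eq0.
by move=> [k _ [-> ->]]; rewrite zE // !eqxx eq_sym.
Qed.

End Feasible.

Lemma feasible_hamiltonian (R : realFieldType) (n : nat) (o : 'I_n) (beta : R)
    (x z : 'I_n -> 'I_n -> R) :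
    0 < beta -> beta < 1 -> TSPH_feasible o beta x z ->
  hamiltonian_cycle (selected_arcs z).
Proof.
move=> beta0 beta1 feas; have [f fP] := feasible_successor feas.
have f_neq i := (fP i).1; have zE i := (fP i).2.
rewrite (feasible_selected_arcs f_neq zE).
have f_inj := feasible_successor_inj beta0 feas f_neq zE.
apply: (hamiltonian_cycle_orbit (o := o) f_inj).
apply: (iter_contraction beta1 f_inj (ltW beta0)).
  exact: (feasible_flow_gt0 beta0 feas).
exact: (feasible_flow_step beta0 feas).
Qed.

(** * From Hamiltonian cycles to feasible points *)

(** Rotating the list preserves [next]; starting at [o] lets positions serve as exponents of
    [beta]. *)
Lemma hamiltonian_cycle_from (n : nat) (o : 'I_n) (A : {set 'I_n * 'I_n}) :
    hamiltonian_cycle A ->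
  exists s, [/\ uniq (o :: s), forall i, i \in o :: s & A = cycle_arcs (o :: s)].
Proof.
case=> p [p_uniq p_all ->]; have [k s rot_p] := rot_to (p_all o).
exists s; rewrite -rot_p rot_uniq; split=> // [i|]; first by rewrite mem_rot.
apply/setP=> a; apply/imsetP/imsetP => -[i _ ->]; exists i => //;
  by rewrite ?mem_rot // next_rot.
Qed.

Section Tour.

Variables (n : nat) (o : 'I_n) (s : seq 'I_n).
Hypotheses (p_uniq : uniq (o :: s)) (p_all : forall i, i \in o :: s).
Let p := o :: s.

Lemma tour_size : size p = n.
Proof.
rewrite -(card_uniqP p_uniq) -[RHS]card_ord; apply: eq_card => i.
by rewrite p_all.
Qed.

(** The tail [s] is [p] shifted by one; at the last node the index runs past [s], and the default
    [o] closes the cycle. *)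
Lemma next_tourE i : next p i = nth o s (index i p).
Proof. by rewrite next_nth p_all. Qed.

Lemma next_tour_inj : injective (next p).
Proof. exact: can_inj (prev_next p_uniq). Qed.

Lemma index_next_tour i : next p i != o -> index (next p i) p = (index i p).+1.
Proof.
have := p_all i; rewrite -index_mem [size _]/= ltnS => le_is.
rewrite next_tourE; have [lt_is | ge_is] := ltnP (index i p) (size s).
  by rewrite -[nth o s _]/(nth o p _.+1) index_uniq.
by rewrite nth_default // eqxx.
Qed.

(** Since [o] is not in [s], it can only come from the default of [nth], that is, at the last
    position. *)
Lemma index_prev_tour i : next p i = o -> (index i p).+1 = n.
Proof.
have := p_all i; rewrite -index_mem [size _]/= ltnS => le_is.
rewrite next_tourE; have [lt_is nth_o | ge_is _] := ltnP (index i p) (size s).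
  by case/andP: p_uniq => /negP[]; rewrite -nth_o mem_nth.
by apply: etrans tour_size; apply/eqP; rewrite eqSS eqn_leq le_is.
Qed.

Lemma next_tour_neq i : (1 < n)%N -> next p i != i.
Proof.
move=> n_gt1; apply/eqP => fix_i; have [io | io] := eqVneq i o.
  have := index_prev_tour (etrans fix_i io).
  by rewrite io /= eqxx => n1; rewrite -n1 in n_gt1.
have := @index_next_tour i; rewrite fix_i => /(_ io) /eqP.
by rewrite eqn_leq ltnn andbF.
Qed.

Variables (R : realFieldType) (beta : R).
Let z i j : R := (j == next p i)%:R.
Let x i j : R := beta ^+ index i p * z i j.

Lemma tour_feasible :
  (1 < n)%N -> 0 < beta -> beta < 1 -> TSPH_feasible o beta x z.
Proof.
move=> n_gt1 beta0 beta1; have neq i := next_tour_neq i n_gt1.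
have outz i : \sum_(j | j != i) z i j = 1.
  rewrite (bigD1 (next p i)) ?neq // big1 => [|j /andP[_ /negbTE jf]]; last first.
    by rewrite /z jf.
  by rewrite /z eqxx /= addr0.
have outx i : \sum_(j | j != i) x i j = beta ^+ index i p.
  by rewrite -mulr_sumr outz mulr1.
have pred i : next p (prev p i) = i := next_prev p_uniq i.
have inx i : \sum_(j | j != i) x j i = beta ^+ index (prev p i) p.
  (* With the node written as a successor, injectivity of [next p] leaves a single incoming arc. *)
  rewrite -{1 2}(pred i); move: (prev p i) => {}i.
  rewrite (bigD1 i) 1?eq_sym ?neq // big1 => [|j /andP[_ ji]]; last first.
    by rewrite /x /z (inj_eq next_tour_inj) eq_sym (negbTE ji) mulr0.
  by rewrite /x /z eqxx mulr1 /= addr0.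
have index_o : index o p = 0%N by rewrite /= eqxx.
split.
- by rewrite outx index_o inx -exprS index_prev_tour.
- move=> i io; by rewrite outx inx -exprS -index_next_tour pred // subrr.
- by rewrite outx index_o.
- by move=> j jo; rewrite /x index_o mul1r.
- move=> j jo; rewrite /x /z; case: eqP => [jE | _]; last by rewrite !mulr0.
  by rewrite -{2}(index_prev_tour (esym jE)) subn1.
- move=> i j io jo ij; rewrite /x /z; case: eqP => [jE | _]; last first.
    by rewrite !mulr0.
  (* As [i] is not first and [j] is not [o], the exponent lies between [1] and [n - 2], which gives
     the two bounds. *)
  have i_gt0 : (0 < index i p)%N by rewrite /= [o == i]eq_sym (negbTE io).
  have := p_all j; rewrite -index_mem jE index_next_tour -?jE // tour_size => lt_in.
  rewrite !mulr1; split; last rewrite -[leRHS]expr1.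
    apply: ler_wiXn2l; rewrite ?ltW //.
    by rewrite -(leq_add2r 2) addn2 subnK.
  by apply: ler_wiXn2l; rewrite ?ltW.
- exact: outz.
- by move=> i j _; rewrite mulr_ge0 ?exprn_ge0 ?ler0n // ltW.
by move=> i j _; rewrite /z; case: eqP; [right | left].
Qed.

Lemma tour_selected_arcs : (1 < n)%N -> selected_arcs z = cycle_arcs p.
Proof.
move=> n_gt1; have neq i : next p i != i by exact: next_tour_neq.
rewrite (feasible_selected_arcs neq) //.
by apply/setP=> a; apply/imsetP/imsetP => -[i _ ->]; exists i; rewrite ?p_all.
Qed.

End Tour.

Lemma hamiltonian_feasible (R : realFieldType) (n : nat) (o : 'I_n) (beta : R)
    (A : {set 'I_n * 'I_n}) :
    (1 < n)%N -> 0 < beta -> beta < 1 -> hamiltonian_cycle A ->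
  exists x z, TSPH_feasible o beta x z /\ selected_arcs z = A.
Proof.
move=> n_gt1 beta0 beta1 /(hamiltonian_cycle_from o)[s [s_uniq s_all ->]].
do 2 eexists; split; first exact: (tour_feasible s_uniq s_all).
exact: tour_selected_arcs.
Qed.

(** * Optimal values *)

(** Tours are listed by the duplicate-free [n]-tuples of nodes, a finite set containing the
    enumeration of ['I_n]. *)
Lemma min_tour_length_exists (R : realFieldType) (n : nat)
    (c : 'I_n -> 'I_n -> R) :
  exists v, min_tour_length c v.
Proof.
have enum_n : size (enum 'I_n) == n by rewrite size_enum_ord.
pose len (t : n.-tuple 'I_n) := tour_length c (cycle_arcs t).
case: (@arg_minP _ _ _ (Tuple enum_n) (fun t => uniq t) len (enum_uniq _)).
move=> t t_uniq t_min; exists (len t); split.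
  exists (cycle_arcs t); split=> //; exists t; split=> // i.
  have sub_enum : {subset t <= enum 'I_n} by move=> j; rewrite mem_enum.
  have [|_ ->] := uniq_min_size t_uniq sub_enum; last by rewrite mem_enum.
  by rewrite size_enum_ord size_tuple.
move=> _ [_ [[p [p_uniq p_all ->]] ->]].
have size_p : size p == n.
  by rewrite -(card_uniqP p_uniq) -[X in _ == X]card_ord; apply/eqP/eq_card.
exact: (t_min (Tuple size_p)).
Qed.

Theorem mainTheorem3 (R : realFieldType) (n : nat) (hn : (2 < n)%N)
    (beta : R) (hbeta0 : 0 < beta) (hbeta1 : beta < 1)
    (c : 'I_n -> 'I_n -> R) :
  [/\ (forall x z : 'I_n -> 'I_n -> R,
         TSPH_feasible (node1 hn) beta x z ->
         hamiltonian_cycle (selected_arcs z)),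
      (forall A : {set 'I_n * 'I_n},
         hamiltonian_cycle A ->
         exists x z : 'I_n -> 'I_n -> R,
           TSPH_feasible (node1 hn) beta x z /\ selected_arcs z = A)
    & exists v : R,
        TSPH_optimal_value (node1 hn) beta c v /\ min_tour_length c v].
Proof.
have ham x z : TSPH_feasible (node1 hn) beta x z ->
  hamiltonian_cycle (selected_arcs z) by exact: feasible_hamiltonian.
have feas A : hamiltonian_cycle A ->
    exists x z, TSPH_feasible (node1 hn) beta x z /\ selected_arcs z = A.
  by apply: hamiltonian_feasible => //; exact: ltnW.
split=> //; have [v v_min] := min_tour_length_exists c; exists v; split=> //.
(* The objective at a feasible point is the length of its selected tour, so both problems range over
   the same values. *)
case: v_min => -[A [/feas[x [z [xz <-]]] ->]] v_min; split.
  by exists x, z; rewrite (tour_length_selected_arcs c (TSPH_binary xz)).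
move=> _ [x' [z' [xz' ->]]].
rewrite (tour_length_selected_arcs c (TSPH_binary xz')).
by apply: v_min; exists (selected_arcs z'); split=> //; apply: ham xz'.
Qed.
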